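(* For all integers $m\ge 2$ and $n\ge 1$, the algebra $A(n,m,m-1)$ is geometrically irreducible.
   Context: $\Bbbk$ is an algebraically closed field of arbitrary characteristic. Paths are composed right to left. For $n\ge 1$, $Q(n)$ is the quiver with vertices $0,1$, a loop $\varepsilon_0$ at $0$, a loop $\varepsilon_1$ at $1$, and $n$ arrows $\alpha_1,\dots,\alpha_n\colon 1\to 0$. $A(n,m,m-1)$ is the path algebra $\Bbbk Q(n)$ modulo the ideal generated by $\varepsilon_0^m$, $\varepsilon_1^m$ and $\sum_{i=0}^{m-1}\varepsilon_0^{\,m-1-i}\alpha_1\varepsilon_1^{\,i}$. For a bound quiver algebra $A=\Bbbk Q/I$ and a dimension vector $\mathbf d\in\mathbb N^{Q_0}$, $\mathrm{rep}_A(\mathbf d)$ is the affine variety of tuples $(V_\alpha)_{\alpha\in Q_1}$, $V_\alpha\in M_{d_{t\alpha}\times d_{s\alpha}}(\Bbbk)$, satisfying all relations in $I$. $A$ is geometrically irreducible if $\mathrm{rep}_A(\mathbf d)$ is irreducible for every dimension vector $\mathbf d$. *)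

(* Defs.v *)
From HB Require Import structures.
From mathcomp Require Import all_boot all_order all_algebra.
Set Implicit Arguments. Unset Strict Implicit. Unset Printing Implicit Defensive.
Import GRing.Theory.
Local Open Scope ring_scope.

Section Zariski.
Variables (K : pzRingType) (T : Type) (I : Type) (coord : I -> T -> K).

Inductive polyfun : (T -> K) -> Prop :=
| pf_const (c : K) : polyfun (fun _ => c)
| pf_coord (i : I) : polyfun (coord i)
| pf_add (f g : T -> K) : polyfun f -> polyfun g -> polyfun (fun x => f x + g x)
| pf_mul (f g : T -> K) : polyfun f -> polyfun g -> polyfun (fun x => f x * g x).

Definition zclosed (Z : T -> Prop) : Prop :=
  exists S : (T -> K) -> Prop, (forall f, S f -> polyfun f) /\
    (forall x, Z x <-> (forall f, S f -> f x = 0)).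

Definition zirreducible (X : T -> Prop) : Prop :=
  (exists x, X x) /\
  forall Z1 Z2, zclosed Z1 -> zclosed Z2 ->
    (forall x, X x -> Z1 x \/ Z2 x) ->
    (forall x, X x -> Z1 x) \/ (forall x, X x -> Z2 x).
End Zariski.

(* A point of the representation space of Q(n) with dimension vector (d0,d1):
   V_{eps_0} : d0 x d0, V_{eps_1} : d1 x d1, V_{alpha_i} : d0 x d1 (alpha_i : 1 -> 0).
   The arrows alpha_1..alpha_n are indexed by 'I_n (alpha_1 = index 0). *)
Record Qrep (K : Type) (n d0 d1 : nat) := mkQrep {
  rep_eps0 : 'M[K]_d0;
  rep_eps1 : 'M[K]_d1;
  rep_alpha : 'I_n -> 'M[K]_(d0, d1)
}.

Definition Qcoord (K : Type) (n d0 d1 : nat) :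
  ('I_d0 * 'I_d0 + 'I_d1 * 'I_d1 + 'I_n * 'I_d0 * 'I_d1)%type -> Qrep K n d0 d1 -> K :=
  fun c V => match c with
  | inl (inl (i, j)) => rep_eps0 V i j
  | inl (inr (i, j)) => rep_eps1 V i j
  | inr (k, i, j) => rep_alpha V k i j
  end.

(* rep_{A(n,m,m-1)}(d): eps0^m = 0, eps1^m = 0,
   sum_{i=0}^{m-1} eps0^(m-1-i) alpha_1 eps1^i = 0 (paths composed right to left) *)
Definition repA (K : pzRingType) (n m d0 d1 : nat) (V : Qrep K n d0 d1) : Prop :=
  rep_eps0 V ^+ m = 0 /\ rep_eps1 V ^+ m = 0 /\
  forall a : 'I_n, nat_of_ord a = 0%N ->
    \sum_(i < m) (rep_eps0 V ^+ (m - 1 - i) *m rep_alpha V a *m rep_eps1 V ^+ i) = 0.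

Definition geometrically_irreducible_Anm (K : pzRingType) (n m : nat) : Prop :=
  forall d0 d1 : nat, zirreducible (@Qcoord K n d0 d1) (@repA K n m d0 d1).

(* Main.v *)
Require Import Defs.
From mathcomp Require Import all_boot all_order all_algebra.
From mathcomp Require Import ring zify.
From Stdlib Require Import FunctionalExtensionality Classical.
Set Implicit Arguments. Unset Strict Implicit. Unset Printing Implicit Defensive.
Import GRing.Theory.
Local Open Scope ring_scope.

(** An [m]-nilpotent block triangular matrix
    [E = block_mx eps0 alpha_1 0 eps1] encodes the three matrices subject to
    relations, because the upper right block of [E ^+ m] is the relation
    sum.  Its projection to the module [eps0] is a surjective map of
    [K[x]/(x^m)]-modules, so the representation variety is a rational image
    of (an open subset of) the variety [H] of triples [(N, N', h)] with
    [N ^+ m = 0], [N' ^+ m = 0] and [N h = h N'], times an affine space.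

    [H] is irreducible for all sizes [d], [e] of [N], [N'], by induction on
    [d + e].  By transposition assume [e <= d], and lower [m] to [d] if
    [d < m].  Where [N ^+ (m - 1) <> 0], a free summand splits off the source
    of [h], so this open part is the image of the variety for [d - m], a
    general linear group and an affine space.  It is dense: when
    [N ^+ k <> 0], [N ^+ k.+1 = 0] and [k.+1 < m], explicit lines in [H] through
    the given point contain points with [N ^+ k.+1 <> 0]. *)

(** * Irreducibility and closure through polynomial functions *)

(** Open-set form of irreducibility: two nonempty principal open subsets meet. It is verified by
    exhibiting a single point. *)
Definition irreducible_set (K : pzRingType) (T I : Type) (c : I -> T -> K)
    (X : T -> Prop) : Prop :=
  (exists x, X x) /\
  forall f g, polyfun c f -> polyfun c g ->
    (exists2 x, X x & f x != 0) -> (exists2 x, X x & g x != 0) ->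
    exists x, [/\ X x, f x != 0 & g x != 0].

Definition zclosure (K : pzRingType) (T I : Type) (c : I -> T -> K)
    (A : T -> Prop) (x : T) : Prop :=
  forall f, polyfun c f -> f x != 0 -> exists2 y, A y & f y != 0.

Section Topology.
Variables (K : idomainType) (T I : Type) (c : I -> T -> K).
Implicit Types (X A B : T -> Prop).

(** A closed set not containing [X] has an equation that is nonzero somewhere on [X]; a point where
    two such equations are both nonzero escapes both closed sets. *)
Lemma irreducible_set_zirreducible X : irreducible_set c X -> zirreducible c X.
Proof.
case=> X0 irrX; split=> // Z1 Z2 [S1 [pS1 ZS1]] [S2 [pS2 ZS2]] cover.
have sep (Z : T -> Prop) (S : (T -> K) -> Prop) :
    (forall x, Z x <-> (forall f, S f -> f x = 0)) ->
    ~ (forall x, X x -> Z x) -> exists f, S f /\ exists2 x, X x & f x != 0.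
  move=> ZS nXZ; apply: NNPP => no; apply: nXZ => x Xx; apply/ZS => f Sf.
  by apply/eqP; apply: contra_notT no => fx; exists f; split=> //; exists x.
case: (classic (forall x, X x -> Z1 x)) => [|/(sep _ _ ZS1)[f [S1f fX]]]; first by left.
case: (classic (forall x, X x -> Z2 x)) => [|/(sep _ _ ZS2)[g [S2g gX]]]; first by right.
have [x [Xx fx gx]] := irrX _ _ (pS1 _ S1f) (pS2 _ S2g) fX gX.
case: (cover x Xx) => [/ZS1/(_ _ S1f) fx0|/ZS2/(_ _ S2g) gx0].
  by rewrite fx0 eqxx in fx.
by rewrite gx0 eqxx in gx.
Qed.

Lemma sub_zclosure A x : A x -> zclosure c A x.
Proof. by move=> Ax f _ fx; exists x. Qed.

Lemma zclosure_idem A x : zclosure c (zclosure c A) x -> zclosure c A x.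
Proof. by move=> clA f pf /(clA f pf)[y Ay fy]; apply: Ay. Qed.

Lemma zclosure_sub A B x :
  (forall y, A y -> B y) -> zclosure c A x -> zclosure c B x.
Proof. by move=> AB clA f pf /(clA f pf)[y /AB By fy]; exists y. Qed.

Lemma irreducible_set_dense A X :
  (forall x, A x -> X x) -> (forall x, X x -> zclosure c A x) ->
  irreducible_set c A -> irreducible_set c X.
Proof.
move=> AX XA [[x0 Ax0] irrA]; split; first by exists x0; apply: AX.
move=> f g pf pg [x Xx fx] [y Xy gy].
have [x' Ax' fx'] := XA x Xx f pf fx; have [y' Ay' gy'] := XA y Xy g pg gy.
have [|| z [Az fz gz]] := irrA f g pf pg; first by exists x'.
  by exists y'.
by exists z; split=> //; apply: AX.
Qed.

Lemma polyfun_comp (T' I' : Type) (c' : I' -> T' -> K) (phi : T' -> T) f :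
  (forall i, polyfun c' (fun x => c i (phi x))) -> polyfun c f ->
  polyfun c' (fun x => f (phi x)).
Proof.
move=> cphi; elim=> {f} [a|i|f g _ pf _ pg|f g _ pf _ pg].
- exact: pf_const.
- exact: cphi.
- exact: pf_add pf pg.
- exact: pf_mul pf pg.
Qed.

Lemma polyfun_path f (gamma : K -> T) :
  (forall i, exists p : {poly K}, forall t, c i (gamma t) = p.[t]) ->
  polyfun c f -> exists p : {poly K}, forall t, f (gamma t) = p.[t].
Proof.
move=> cgamma; elim=> {f} [a|i|f g _ [p fp] _ [q gq]|f g _ [p fp] _ [q gq]].
- by exists a%:P => t; rewrite hornerC.
- exact: cgamma.
- by exists (p + q) => t; rewrite hornerD fp gq.
- by exists (p * q) => t; rewrite hornerM fp gq.
Qed.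

End Topology.

Lemma poly_common_nonroot (K : closedFieldType) (p q : {poly K}) :
  p != 0 -> q != 0 -> exists t, [/\ t != 0, p.[t] != 0 & q.[t] != 0].
Proof.
(* The factor ['X] keeps the nonroot away from 0. *)
move=> p0 q0; have /closed_nonrootP[t] : 'X * p * q != 0.
  by rewrite !mulf_neq0 ?polyX_eq0.
by rewrite !rootM rootX !negb_or => /andP[/andP[t0 pt] qt]; exists t.
Qed.

(** Along the curve a polynomial function becomes a polynomial in [t]; if nonzero at 0, it is
    nonzero at some [t != 0]. *)
Lemma zclosure_path (K : closedFieldType) (T I : Type) (c : I -> T -> K)
    (A : T -> Prop) (gamma : K -> T) :
  (forall i, exists p : {poly K}, forall t, c i (gamma t) = p.[t]) ->
  (forall t, t != 0 -> A (gamma t)) -> zclosure c A (gamma 0).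
Proof.
move=> cgamma Agamma f pf; have [p fp] := polyfun_path cgamma pf.
rewrite fp => p0; have pn0 : p != 0.
  by apply: contraNneq p0 => ->; rewrite horner0.
have [t [t0 pt _]] := poly_common_nonroot pn0 pn0.
by exists (gamma t); [apply: Agamma | rewrite fp].
Qed.

(** * Regular functions and images of irreducible sets *)

Section Regular.
Variables (K : fieldType) (T I : Type) (c : I -> T -> K) (X : T -> Prop).

(** A fraction with one global denominator: [f] and the numerator [p] have the same zeros on [X]. *)
Definition regular (f : T -> K) : Prop :=
  exists p d, [/\ polyfun c p, polyfun c d &
                  forall x, X x -> d x != 0 /\ p x = d x * f x].

Lemma regular_poly f : polyfun c f -> regular f.
Proof.
move=> pf; exists f, (fun=> 1); split=> //; first exact: pf_const.
by move=> x _; rewrite mul1r oner_neq0.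
Qed.

Lemma eq_regular f g : (forall x, X x -> f x = g x) -> regular f -> regular g.
Proof.
move=> fg [p [d [pp pd pf]]]; exists p, d; split=> // x Xx.
by rewrite -fg //; apply: pf.
Qed.

Lemma regularD f g : regular f -> regular g -> regular (fun x => f x + g x).
Proof.
move=> [p [d [pp pd pf]]] [q [d' [pq pd' qg]]].
exists (fun x => p x * d' x + q x * d x), (fun x => d x * d' x); split.
- by apply: pf_add; apply: pf_mul.
- exact: pf_mul.
move=> x Xx; have [dx ->] := pf x Xx; have [d'x ->] := qg x Xx.
rewrite mulf_neq0 //; split=> //.
by ring.
Qed.

Lemma regularM f g : regular f -> regular g -> regular (fun x => f x * g x).
Proof.
move=> [p [d [pp pd pf]]] [q [d' [pq pd' qg]]].
exists (fun x => p x * q x), (fun x => d x * d' x); split; try exact: pf_mul.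
move=> x Xx; have [dx ->] := pf x Xx; have [d'x ->] := qg x Xx.
by rewrite mulf_neq0 //; split=> //; rewrite mulrACA.
Qed.

Lemma regularV f : (forall x, X x -> f x != 0) -> regular f ->
  regular (fun x => (f x)^-1).
Proof.
move=> f0 [p [d [pp pd pf]]]; exists d, p; split=> // x Xx.
have [dx ->] := pf x Xx; rewrite mulf_neq0 ?f0 //; split=> //.
by rewrite mulfK ?f0.
Qed.

Lemma regular_const a : regular (fun=> a).
Proof. by apply: regular_poly; apply: pf_const. Qed.

Lemma regular_sum (J : Type) (r : seq J) (P : pred J) (F : J -> T -> K) :
  (forall j, regular (F j)) -> regular (fun x => \sum_(j <- r | P j) F j x).
Proof.
move=> rF; elim: r => [|j r IH].
  by apply: eq_regular (regular_const 0) => x _; rewrite big_nil.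
apply: (@eq_regular (fun x => (if P j then F j x else 0) + \sum_(j <- r | P j) F j x)).
  by move=> x _; rewrite big_cons; case: ifP => // _; rewrite add0r.
by apply: regularD IH; case: (P j); [apply: rF | apply: regular_const].
Qed.

Lemma regular_prod (J : Type) (r : seq J) (P : pred J) (F : J -> T -> K) :
  (forall j, regular (F j)) -> regular (fun x => \prod_(j <- r | P j) F j x).
Proof.
move=> rF; elim: r => [|j r IH].
  by apply: eq_regular (regular_const 1) => x _; rewrite big_nil.
apply: (@eq_regular (fun x => (if P j then F j x else 1) * \prod_(j <- r | P j) F j x)).
  by move=> x _; rewrite big_cons; case: ifP => // _; rewrite mul1r.
by apply: regularM IH; case: (P j); [apply: rF | apply: regular_const].
Qed.

Definition regular_mx p q (F : T -> 'M[K]_(p, q)) : Prop :=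
  forall i j, regular (fun x => F x i j).

Lemma eq_regular_mx p q (F G : T -> 'M[K]_(p, q)) :
  (forall x, X x -> F x = G x) -> regular_mx F -> regular_mx G.
Proof. by move=> FG rF i j; apply: eq_regular (rF i j) => x /FG->. Qed.

Lemma regular_mx_const p q (A : 'M[K]_(p, q)) : regular_mx (fun=> A).
Proof. by move=> i j; apply: regular_const. Qed.

Lemma regular_mxM p q r (F : T -> 'M[K]_(p, q)) (G : T -> 'M[K]_(q, r)) :
  regular_mx F -> regular_mx G -> regular_mx (fun x => F x *m G x).
Proof.
move=> rF rG i j.
apply: (@eq_regular (fun x => \sum_k F x i k * G x k j)).
  by move=> x _; rewrite mxE.
by apply: regular_sum => k; apply: regularM.
Qed.

Lemma regular_mxX p (F : T -> 'M[K]_p) k :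
  regular_mx F -> regular_mx (fun x => F x ^+ k).
Proof.
move=> rF; elim: k => [|k IH]; first exact: regular_mx_const.
apply: (@eq_regular_mx _ _ (fun x => F x *m F x ^+ k)).
  by move=> x _; rewrite exprS.
exact: regular_mxM.
Qed.

Lemma regular_mx_tr p q (F : T -> 'M[K]_(p, q)) :
  regular_mx F -> regular_mx (fun x => (F x)^T).
Proof. by move=> rF i j; apply: eq_regular (rF j i) => x _; rewrite mxE. Qed.

Lemma regular_col_mx p1 p2 q (F : T -> 'M[K]_(p1, q)) (G : T -> 'M[K]_(p2, q)) :
  regular_mx F -> regular_mx G -> regular_mx (fun x => col_mx (F x) (G x)).
Proof.
move=> rF rG i j; case: (split_ordP i) => k ->.
  by apply: eq_regular (rF k j) => x _; rewrite col_mxEu.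
by apply: eq_regular (rG k j) => x _; rewrite col_mxEd.
Qed.

Lemma regular_row_mx p q1 q2 (F : T -> 'M[K]_(p, q1)) (G : T -> 'M[K]_(p, q2)) :
  regular_mx F -> regular_mx G -> regular_mx (fun x => row_mx (F x) (G x)).
Proof.
move=> rF rG i j; case: (split_ordP j) => k ->.
  by apply: eq_regular (rF i k) => x _; rewrite row_mxEl.
by apply: eq_regular (rG i k) => x _; rewrite row_mxEr.
Qed.

Lemma regular_det p (F : T -> 'M[K]_p) :
  regular_mx F -> regular (fun x => \det (F x)).
Proof.
move=> rF; apply: regular_sum => s; apply: regularM; first exact: regular_const.
by apply: regular_prod => i; apply: rF.
Qed.

(** Cramer's rule: the entries are signed minors over the determinant. *)
Lemma regular_invmx p (F : T -> 'M[K]_p) :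
  (forall x, X x -> F x \in unitmx) -> regular_mx F ->
  regular_mx (fun x => invmx (F x)).
Proof.
move=> uF rF i j.
apply: (@eq_regular (fun x => (\det (F x))^-1 * (\adj (F x)) i j)).
  by move=> x Xx; rewrite /invmx uF // [in RHS]mxE.
apply: regularM.
  by apply: regularV; [move=> x /uF Fx; rewrite -unitfE -unitmxE | apply: regular_det].
apply: (@eq_regular (fun x => (-1) ^+ (j + i) * \det (row' j (col' i (F x))))).
  by move=> x _; rewrite mxE.
apply: regularM; first exact: regular_const.
apply: regular_det => k l.
by apply: eq_regular (rF (lift j k) (lift i l)) => x _; rewrite !mxE.
Qed.

Lemma regular_comp (T' I' : Type) (c' : I' -> T' -> K) (phi : T -> T') f :
  (forall i, regular (fun x => c' i (phi x))) -> polyfun c' f ->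
  regular (fun x => f (phi x)).
Proof.
move=> cphi; elim=> {f} [a|i|f g _ pf _ pg|f g _ pf _ pg].
- exact: regular_const.
- exact: cphi.
- exact: regularD.
- exact: regularM.
Qed.

(** Clearing denominators in the two pulled-back functions leaves polynomials with the same zeros on
    [X], to which irreducibility of [X] applies. *)
Lemma irreducible_set_image (T' I' : Type) (c' : I' -> T' -> K) (phi : T -> T')
    (Y : T' -> Prop) :
  (forall i, regular (fun x => c' i (phi x))) ->
  (forall x, X x -> Y (phi x)) -> (forall y, Y y -> exists2 x, X x & phi x = y) ->
  irreducible_set c X -> irreducible_set c' Y.
Proof.
move=> cphi XY YX [[x0 Xx0] irrX]; split; first by exists (phi x0); apply: XY.
move=> f g pf pg [_ /YX[x Xx <-] fx] [_ /YX[y Xy <-] gy].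
have [p [d [pp _ pfE]]] := regular_comp cphi pf.
have [q [d' [pq _ qgE]]] := regular_comp cphi pg.
have [||z [Xz pz qz]] := irrX p q pp pq.
- by exists x => //; have [dx ->] := pfE x Xx; rewrite mulf_neq0.
- by exists y => //; have [dx ->] := qgE y Xy; rewrite mulf_neq0.
exists (phi z); split; first exact: XY.
  by have [_ E] := pfE z Xz; apply: contraNneq pz => fz; rewrite E fz mulr0.
by have [_ E] := qgE z Xz; apply: contraNneq qz => fz; rewrite E fz mulr0.
Qed.

Lemma irreducible_set_open d : regular d -> irreducible_set c X ->
  (exists2 x, X x & d x != 0) -> irreducible_set c (fun x => X x /\ d x != 0).
Proof.
move=> [p [q [pp _ pqd]]] [_ irrX] [x0 Xx0 dx0]; split; first by exists x0.
have p0 x : X x -> (p x != 0) = (d x != 0).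
  by move=> /pqd[qx ->]; rewrite mulf_eq0 (negPf qx).
move=> f g pf pg [x [Xx dx] fx] [y [Xy dy] gy].
have [||z [Xz]] := irrX _ _ (pf_mul pf pp) (pf_mul pg pp).
- by exists x; rewrite ?mulf_neq0 ?p0.
- by exists y; rewrite ?mulf_neq0 ?p0.
by rewrite !mulf_eq0 !negb_or p0 // => /andP[fz dz] /andP[gz _]; exists z.
Qed.

End Regular.

(** * Products with matrix spaces *)

Definition mx_coord (K : Type) p q (ij : 'I_p * 'I_q) (A : 'M[K]_(p, q)) : K :=
  A ij.1 ij.2.

Definition prod_coord (K T T' I I' : Type) (c : I -> T -> K) (c' : I' -> T' -> K)
    (i : I + I') (x : T * T') : K :=
  match i with inl i => c i x.1 | inr i => c' i x.2 end.

Section Product.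
Variables (K : closedFieldType) (T I : Type) (c : I -> T -> K) (p q : nat).
Let cA := prod_coord c (@mx_coord K p q).

(** With the matrix coordinates frozen at [a] and [b], irreducibility of [X] gives one base point
    [z] for both functions; the line from [a] to [b] over [z] then contains a common point. *)
Lemma irreducible_set_prod_mx X : irreducible_set c X ->
  irreducible_set cA (fun x => X x.1).
Proof.
case=> [[x0 Xx0] irrX]; split; first by exists (x0, 0).
move=> f g pf pg [[x a] /= Xx fx] [[y b] /= Xy gy].
have slice a' h : polyfun cA h -> polyfun c (fun x => h (x, a')).
  apply: polyfun_comp => -[i|i]; first exact: (pf_coord c i).
  exact: pf_const.
have [||z [Xz fz gz]] := irrX _ _ (slice a _ pf) (slice b _ pg).
- by exists x.
- by exists y.
have line i : exists r : {poly K}, forall t, cA i (z, a + t *: (b - a)) = r.[t].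
  case: i => [i|[i j]]; first by exists (c i z)%:P => t; rewrite hornerC.
  exists ((a i j)%:P + (b i j - a i j) *: 'X) => t.
  by rewrite /= /mx_coord /= !mxE hornerD hornerC hornerZ hornerX mulrC.
have [r fr] := polyfun_path line pf; have [s gs] := polyfun_path line pg.
have r0 : r != 0.
  by apply: contraNneq fz => r0; have := fr 0; rewrite scale0r addr0 r0 horner0 => ->.
have s0 : s != 0.
  apply: contraNneq gz => s0; have := gs 1.
  by rewrite scale1r addrC subrK s0 horner0 => ->.
have [t [_ rt st]] := poly_common_nonroot r0 s0.
by exists (z, a + t *: (b - a)); rewrite fr gs.
Qed.

End Product.

(** * Powers of perturbed ring elements *)

Section RingPowers.
Variable R : pzRingType.
Implicit Types a b : R.

(** In the expansion, a word with [b] before its last place contains [b * a] or [b * b]. *)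
Lemma exprS_addr_sq0_l a b j : b * a = 0 -> b * b = 0 ->
  (a + b) ^+ j.+1 = a ^+ j.+1 + a ^+ j * b.
Proof.
move=> ba bb; elim: j => [|j IH]; first by rewrite !expr1 expr0 mul1r.
by rewrite exprSr IH mulrDl !mulrDr -!exprSr -!mulrA ba bb !mulr0 !addr0.
Qed.

Lemma exprS_addr_sq0_r a b j : a * b = 0 -> b * b = 0 ->
  (a + b) ^+ j.+1 = a ^+ j.+1 + b * a ^+ j.
Proof.
move=> ab bb; elim: j => [|j IH]; first by rewrite !expr1 expr0 mulr1.
by rewrite exprS IH mulrDr !mulrDl -!exprS !mulrA ab bb !mul0r add0r addr0.
Qed.

(** Words with two or more letters [b] contain some [b * a ^+ i * b]. *)
Lemma expr_addr_sandwich0 a b j : (forall i, b * a ^+ i * b = 0) ->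
  (a + b) ^+ j = a ^+ j + \sum_(i < j) a ^+ i * b * a ^+ (j - 1 - i).
Proof.
move=> bab; elim: j => [|j IH]; first by rewrite big_ord0 addr0.
rewrite exprS IH mulrDr mulrDl -exprS -addrA; congr (_ + _).
rewrite big_ord_recl expr0 mul1r /= subn1 subn0 mulrDl; congr (_ + _).
  by rewrite subn1.
rewrite !mulr_sumr [X in _ + X]big1 ?addr0 => [|i _]; last first.
  by rewrite !mulrA bab mul0r.
apply: eq_bigr => i _.
by rewrite /bump !mulrA -exprS add1n !subn1 /= -subn1 -subnDA add1n.
Qed.

Lemma expr0_leq a i j : a ^+ i = 0 -> (i <= j)%N -> a ^+ j = 0.
Proof. by move=> ai /subnK <-; rewrite exprD ai mulr0. Qed.

End RingPowers.

(** * Nilpotent matrices and intertwiners *)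

Section Matrices.
Variable K : fieldType.

Lemma mulmx_expS d p (N : 'M[K]_d) j (A : 'M_(p, d)) :
  A *m N ^+ j.+1 = A *m N *m N ^+ j.
Proof. by rewrite exprS -mulmxE mulmxA. Qed.

Lemma mulmx_expSr d p (N : 'M[K]_d) j (A : 'M_(p, d)) :
  A *m N ^+ j.+1 = A *m N ^+ j *m N.
Proof. by rewrite exprSr -mulmxE mulmxA. Qed.

Lemma mulmx_expD d p (N : 'M[K]_d) i j (A : 'M_(p, d)) :
  A *m N ^+ i *m N ^+ j = A *m N ^+ (i + j).
Proof. by rewrite exprD -mulmxE mulmxA. Qed.

Lemma intertwine_exp d e (N : 'M[K]_d) (N' : 'M_e) (h : 'M_(d, e)) j :
  N *m h = h *m N' -> N ^+ j *m h = h *m N' ^+ j.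
Proof.
move=> Nh; elim: j => [|j IH]; first by rewrite !expr0 mulmx1 mul1mx.
by rewrite mulmx_expSr -IH exprSr -mulmxE -!mulmxA Nh.
Qed.

Lemma trmx_exp d (N : 'M[K]_d) j : (N ^+ j)^T = N^T ^+ j.
Proof.
elim: j => [|j IH]; first exact: trmx1.
by rewrite exprS exprSr -mulmxE trmx_mul IH.
Qed.

Lemma exists_row_neq0 p q (A : 'M[K]_(p, q)) : A != 0 -> exists g : 'rV_p, g *m A != 0.
Proof.
move=> A0; apply: NNPP => no; case/eqP: A0; apply/row_matrixP => i.
rewrite row0 rowE; apply/eqP; apply: contra_notT no => Ai; by exists (delta_mx 0 i).
Qed.

Lemma exists_col_neq0 p q (A : 'M[K]_(p, q)) : A != 0 -> exists y : 'cV_q, A *m y != 0.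
Proof.
rewrite -trmx_eq0 => /exists_row_neq0[g gA]; exists g^T.
by rewrite -trmx_eq0 trmx_mul trmxK.
Qed.

Lemma exists_row_neq0_both p q r (A : 'M[K]_(p, q)) (B : 'M_(p, r)) :
  A != 0 -> B != 0 -> exists g : 'rV_p, g *m A != 0 /\ g *m B != 0.
Proof.
move=> /exists_row_neq0[a aA] /exists_row_neq0[b bB].
case: (eqVneq (a *m B) 0) => [aB|]; last by exists a.
case: (eqVneq (b *m A) 0) => [bA|]; last by exists b.
by exists (a + b); rewrite !mulmxDl aB bA addr0 add0r.
Qed.

Lemma mul_col_row_neq0 p q (u : 'cV[K]_p) (v : 'rV_q) :
  u != 0 -> v != 0 -> u *m v != 0.
Proof.
move=> /cV0Pn[i ui] /rV0Pn[j vj]; apply/eqP => /matrixP/(_ i j).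
by rewrite !mxE big_ord1 => /eqP; rewrite mulf_eq0 (negPf ui) (negPf vj).
Qed.

(** The last nonzero [V *m N ^+ j] has its rows in [V] and in the kernel of [N]. *)
Lemma nilpotent_stable_kernel d r (N : 'M[K]_d) m (V : 'M_(r, d)) :
  N ^+ m = 0 -> V != 0 -> (V *m N <= V)%MS ->
  exists f : 'rV_d, [/\ f != 0, (f <= V)%MS & f *m N = 0].
Proof.
move=> Nm V0 VN.
have ex : exists j, V *m N ^+ j == 0 by exists m; rewrite Nm mulmx0.
case: (ex_minnP ex) => -[|j] /eqP VNj minj.
  by rewrite expr0 mulmx1 in VNj; rewrite VNj eqxx in V0.
have VNj0 : V *m N ^+ j != 0 by apply/negP => /minj; rewrite ltnn.
have VNi i : (V *m N ^+ i <= V)%MS.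
  elim: i => [|i IH]; first by rewrite expr0 mulmx1.
  by rewrite mulmx_expSr (submx_trans (submxMr N IH)).
have [g gV] := exists_row_neq0 VNj0; exists (g *m (V *m N ^+ j)); split=> //.
  exact: submx_trans (submxMl _ _) (VNi j).
by rewrite -mulmxA -mulmx_expSr VNj mulmx0.
Qed.

(** The kernel of [h] is nonzero and stable under the nilpotent [N]. *)
Lemma common_kernel d e (N : 'M[K]_d) (N' : 'M_e) (h : 'M_(d, e)) m :
  N *m h = h *m N' -> N ^+ m = 0 -> ~~ row_free h ->
  exists f : 'rV_d, [/\ f != 0, f *m N = 0 & f *m h = 0].
Proof.
move=> Nh Nm; rewrite -kermx_eq0 => K0.
have [|f [f0 fK fN]] := nilpotent_stable_kernel Nm K0.
  by apply/sub_kermxP; rewrite -mulmxA Nh mulmxA mulmx_ker mul0mx.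
by exists f; split=> //; apply/sub_kermxP.
Qed.

Lemma common_cokernel d e (N : 'M[K]_d) (N' : 'M_e) (h : 'M_(d, e)) m :
  N *m h = h *m N' -> N' ^+ m = 0 -> ~~ row_full h ->
  exists c : 'cV_e, [/\ c != 0, N' *m c = 0 & h *m c = 0].
Proof.
move=> Nh N'm nf.
have [|||f [f0 fN fh]] := @common_kernel e d N'^T N^T h^T m.
- by rewrite -!trmx_mul Nh.
- by rewrite -trmx_exp N'm trmx0.
- by rewrite /row_free mxrank_tr.
exists f^T; split; first by rewrite trmx_eq0.
  by apply: trmx_inj; rewrite trmx_mul trmxK fN trmx0.
by apply: trmx_inj; rewrite trmx_mul trmxK fh trmx0.
Qed.

(* A nilpotent module generated by one element modulo its radical is cyclic. *)
Lemma exists_functional_kill_radical d (N : 'M[K]_d) k (g : 'rV_d) :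
  N ^+ k = 0 -> (k < d)%N ->
  exists c : 'cV_d, c != 0 /\ col_mx N g *m c = 0.
Proof.
move=> Nk kd; have nf : ~~ row_full (col_mx N g).
  apply/negP => full.
  (* The row space of [N ^+ j] would be spanned by that of [N ^+ j.+1] and one vector, so each step
     would lose at most one dimension, and [N ^+ k = 0] would force [d <= k]. *)
  have rankN j : (d <= \rank (N ^+ j) + j)%N.
    elim: j => [|j IH]; first by rewrite expr0 mxrank1 addn0.
    apply: leq_trans IH _; rewrite addnS -addSn leq_add2r -addn1.
    have : (N ^+ j <= col_mx (N ^+ j.+1) (g *m N ^+ j))%MS.
      have -> : col_mx (N ^+ j.+1) (g *m N ^+ j) = col_mx N g *m N ^+ j.
        by rewrite mul_col_mx exprS.
      by rewrite -{1}[N ^+ j]mul1mx submxMr // sub1mx.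
    move/mxrankS/leq_trans; apply.
    rewrite -addsmxE; apply: leq_trans (mxrank_adds_leqif _ _).1 _.
    by rewrite leq_add2l rank_leq_row.
  by have := rankN k; rewrite Nk mxrank0 add0n leqNgt kd.
have /exists_col_neq0[y y0] : cokermx (col_mx N g) != 0.
  apply: contraNneq nf => c0.
  by rewrite -sub1mx submxE c0 mulmx0.
by exists (cokermx (col_mx N g) *m y); split=> //; rewrite mulmxA mulmx_coker mul0mx.
Qed.

(* The norm of the linear map [y *m v] for the action of [K[x]/(x^k.+1)]. *)
Definition norm_hom d e (N : 'M[K]_d) (N' : 'M_e) k (y : 'cV_d) (v : 'rV_e) : 'M_(d, e) :=
  \sum_(i < k.+1) N ^+ (k - i) *m y *m v *m N' ^+ i.

Section NormHom.
Variables (d e : nat) (N : 'M[K]_d) (N' : 'M[K]_e) (k : nat) (y : 'cV[K]_d) (v : 'rV[K]_e).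
Hypothesis (Nk : N ^+ k.+1 = 0).

(** The two sums agree after an index shift; the leftover end terms contain [N ^+ k.+1] and
    [v *m N' ^+ k.+1]. *)
Lemma norm_hom_intertwine : v *m N' ^+ k.+1 = 0 ->
  N *m norm_hom N N' k y v = norm_hom N N' k y v *m N'.
Proof.
move=> vN'; rewrite /norm_hom mulmx_sumr mulmx_suml big_ord_recl big_ord_recr /=.
have -> : N *m (N ^+ (k - 0) *m y *m v *m N' ^+ 0) = 0.
  by rewrite subn0 !mulmxA mulmxE -exprS Nk !mul0mx.
have -> : N ^+ (k - k) *m y *m v *m N' ^+ k *m N' = 0.
  by rewrite -mulmxA -[N' ^+ k *m N']exprSr -!mulmxA vN' !mulmx0.
rewrite add0r addr0; apply: eq_bigr => i _.
rewrite !mulmxA -[N *m _]exprS -!mulmxA -[N' ^+ i *m N']exprSr.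
by rewrite /bump /= add1n -subSn // subSS.
Qed.

(** Only the term [i = k], free of powers of [N], survives. *)
Lemma exp_mul_norm_hom :
  N ^+ k *m norm_hom N N' k y v = (N ^+ k *m y) *m (v *m N' ^+ k).
Proof.
rewrite /norm_hom mulmx_sumr big_ord_recr /= subnn expr0 mul1mx big1 ?add0r => [|i _].
  by rewrite !mulmxA.
rewrite !mulmxA -[N ^+ k *m N ^+ _]exprD (expr0_leq Nk) ?mul0mx //.
by rewrite -addn1 leq_add2l subn_gt0.
Qed.

Lemma norm_hom_mul_exp j : v *m N' ^+ j.+1 = 0 ->
  norm_hom N N' k y v *m N' ^+ j = (N ^+ k *m y) *m (v *m N' ^+ j).
Proof.
move=> vN'; rewrite /norm_hom mulmx_suml big_ord_recl big1 ?addr0 => [|i _].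
  by rewrite subn0 expr0 mulmx1 !mulmxA.
rewrite -!mulmxA -[N' ^+ _ *m N' ^+ _]exprD /= /bump add1n addSnnS addnC exprD.
by rewrite -mulmxE [v *m _]mulmxA vN' mul0mx !mulmx0.
Qed.

End NormHom.
End Matrices.

(** * The variety of intertwining triples and lines in it *)

Definition hom_coord (K : Type) d e :=
  prod_coord (prod_coord (@mx_coord K d d) (@mx_coord K e e)) (@mx_coord K d e).

(* Matrices act on row vectors, so [p.2] is a [K[x]]-linear map from the
   module [p.1.1] to the module [p.1.2]. *)
Definition hom_variety (K : pzRingType) m d e (p : 'M[K]_d * 'M[K]_e * 'M[K]_(d, e)) :
    Prop :=
  [/\ p.1.1 ^+ m = 0, p.1.2 ^+ m = 0 & p.1.1 *m p.2 = p.2 *m p.1.2].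

Definition hom_variety_index_gt (K : pzRingType) m d e k
    (p : 'M[K]_d * 'M[K]_e * 'M[K]_(d, e)) : Prop :=
  hom_variety m p /\ p.1.1 ^+ k != 0.

Section Deformations.
Variables (K : closedFieldType) (m d e : nat).

Local Notation cl := (zclosure (@hom_coord K d e)).
Local Notation above k := (hom_variety_index_gt m k).

Lemma zclosure_line A (N : 'M[K]_d) (N' : 'M[K]_e) (h : 'M[K]_(d, e)) B B' C :
  (forall t, t != 0 -> A (N + t *: B, N' + t *: B', h + t *: C)) ->
  cl A (N, N', h).
Proof.
move=> At; have line p q (X Y : 'M[K]_(p, q)) ij :
    exists r : {poly K}, forall t, mx_coord ij (X + t *: Y) = r.[t].
  exists ((mx_coord ij X)%:P + mx_coord ij Y *: 'X) => t.
  by rewrite hornerD hornerC hornerZ hornerX /mx_coord !mxE mulrC.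
have := @zclosure_path K _ _ (@hom_coord K d e) A
  (fun t => (N + t *: B, N' + t *: B', h + t *: C)).
by rewrite !scale0r !addr0; apply=> // -[[ij|ij]|ij]; apply: line.
Qed.

(** The line adds multiples of [c *m f] to [N]. As [f *m N] and [f *m c] vanish, powers stay linear
    in [t]; as [f *m h = 0], [N'] can stay fixed. *)
Lemma raise_kernel k (N : 'M[K]_d) (N' : 'M[K]_e) (h : 'M[K]_(d, e))
    (f : 'rV_d) (c : 'cV_d) :
  (k.+1 < m)%N -> hom_variety m (N, N', h) -> N ^+ k.+1 = 0 ->
  f != 0 -> f *m N = 0 -> f *m h = 0 -> f *m c = 0 -> N ^+ k *m c != 0 ->
  cl (above k.+1) (N, N', h).
Proof.
move=> km [/= Nm N'm Nh] Nk f0 fN fh fc Nkc.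
apply: (@zclosure_line _ _ _ _ (c *m f) 0 0) => t t0; rewrite !scaler0 !addr0.
have pow j : (N + t *: (c *m f)) ^+ j.+1 = N ^+ j.+1 + t *: (N ^+ j *m c *m f).
  rewrite exprS_addr_sq0_l; first by rewrite -mulmxE -scalemxAr mulmxA.
    by rewrite -mulmxE -scalemxAl -mulmxA fN mulmx0 scaler0.
  by rewrite -mulmxE -scalemxAl -scalemxAr -mulmxA (mulmxA f) fc mul0mx mulmx0 !scaler0.
split=> [|/=]; last first.
  by rewrite pow Nk add0r scalemx_eq0 negb_or t0 mul_col_row_neq0.
split=> //=; last by rewrite mulmxDl -scalemxAl -mulmxA fh mulmx0 scaler0 addr0.
(* [km] unfolds to [k.+2 <= m], so it is the power [k.+2] that must vanish. *)
apply: expr0_leq km.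
by rewrite pow exprS Nk mulr0 !mul0mx scaler0 addr0.
Qed.

(** The line adds multiples of [c *m v] to [N'], with [N] and [h] fixed. The set [A] is a parameter
    so that an induction on the index of [N'] can continue from the new points. *)
Lemma raise_target j (N : 'M[K]_d) (N' : 'M[K]_e) (h : 'M[K]_(d, e))
    (v : 'rV_e) (c : 'cV_e) A :
  (j.+1 < m)%N -> hom_variety m (N, N', h) -> N' ^+ j.+1 = 0 ->
  c != 0 -> N' *m c = 0 -> h *m c = 0 -> v *m c = 0 -> v *m N' ^+ j != 0 ->
  (forall N'', hom_variety m (N, N'', h) -> N'' ^+ j.+2 = 0 -> N'' ^+ j.+1 != 0 ->
     A (N, N'', h)) ->
  cl A (N, N', h).
Proof.
move=> jm [/= Nm N'm Nh] N'j c0 N'c hc vc vN'j AN''.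
apply: (@zclosure_line _ _ _ _ 0 (c *m v) 0) => t t0; rewrite !scaler0 !addr0.
have pow i : (N' + t *: (c *m v)) ^+ i.+1 = N' ^+ i.+1 + t *: (c *m (v *m N' ^+ i)).
  rewrite exprS_addr_sq0_r; first by rewrite -mulmxE -scalemxAl mulmxA.
    by rewrite -mulmxE -scalemxAr mulmxA N'c mul0mx scaler0.
  by rewrite -mulmxE -scalemxAl -scalemxAr -mulmxA (mulmxA v) vc mul0mx mulmx0 !scaler0.
have pow0 : (N' + t *: (c *m v)) ^+ j.+2 = 0.
  by rewrite pow [N' ^+ j.+2]exprS N'j mulr0 !mulmx0 scaler0 addr0.
apply: AN'' => //; last first.
  by rewrite pow N'j add0r scalemx_eq0 negb_or t0 mul_col_row_neq0.
split=> //=; first exact: expr0_leq jm.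
by rewrite mulmxDr -scalemxAr mulmxA hc mul0mx scaler0 addr0.
Qed.

(** The line adds multiples of [c *m g] to [N]. Since [c] vanishes on the kernel of [h], it factors
    through [h], and the perturbation descends to one of [N']. *)
Lemma raise_surjective k (N : 'M[K]_d) (N' : 'M[K]_e) (h : 'M[K]_(d, e))
    (g : 'rV_d) (c : 'cV_d) :
  (k.+1 < m)%N -> hom_variety m (N, N', h) -> N ^+ k.+1 = 0 -> row_full h ->
  c != 0 -> N *m c = 0 -> g *m c = 0 -> kermx h *m c = 0 -> g *m N ^+ k != 0 ->
  cl (above k.+1) (N, N', h).
Proof.
move=> km [/= Nm N'm Nh] Nk fullh c0 Nc gc Kc gNk.
have hc : h *m (pinvmx h *m c) = c.
  apply/esym/eqP; rewrite -subr_eq0 mulmxA -{1}[c]mul1mx -mulmxBl.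
  have /sub_kermxP/submxP[D ->] : (1%:M - h *m pinvmx h) *m h = 0.
    by rewrite mulmxBl mul1mx mulmxKpV ?subrr.
  by rewrite -mulmxA Kc mulmx0.
apply: (@zclosure_line _ _ _ _ (c *m g) (pinvmx h *m c *m (g *m h)) 0) => t t0.
rewrite scaler0 addr0.
have pow j : (N + t *: (c *m g)) ^+ j.+1 = N ^+ j.+1 + t *: (c *m (g *m N ^+ j)).
  rewrite exprS_addr_sq0_r; first by rewrite -mulmxE -scalemxAl mulmxA.
    by rewrite -mulmxE -scalemxAr mulmxA Nc mul0mx scaler0.
  by rewrite -mulmxE -scalemxAl -scalemxAr -mulmxA (mulmxA g) gc mul0mx mulmx0 !scaler0.
have powm : (N + t *: (c *m g)) ^+ m = 0.
  by apply: expr0_leq km; rewrite pow exprS Nk mulr0 !mulmx0 scaler0 addr0.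
split=> [|/=]; last first.
  by rewrite pow Nk add0r scalemx_eq0 negb_or t0 mul_col_row_neq0.
have inter : (N + t *: (c *m g)) *m h = h *m (N' + t *: (pinvmx h *m c *m (g *m h))).
  by rewrite mulmxDl mulmxDr Nh -scalemxAl -scalemxAr (mulmxA h) hc mulmxA.
(* As [h] is onto, nilpotency passes from source to target. *)
split=> //=; rewrite -[LHS]mul1mx -(mulVpmx fullh) -(mulmxA (pinvmx h) h).
by rewrite -(intertwine_exp _ inter) powm mul0mx mulmx0.
Qed.

(* [a] spans room to extend the chain of [g] inside [kermx h]: redirecting
   [g *m N ^+ j], through its image under [h], to also reach [a] lengthens the
   orbit of [g] by one and leaves the target of [h] unchanged. *)
Lemma raise_extension k j (N : 'M[K]_d) (N' : 'M[K]_e) (h : 'M[K]_(d, e))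
    (g a : 'rV_d) :
  (k.+1 < m)%N -> hom_variety m (N, N', h) -> N ^+ k.+1 = 0 ->
  (j < k)%N -> N' ^+ j.+1 = 0 -> g *m h *m N' ^+ j != 0 -> g *m N ^+ k != 0 ->
  a *m h = 0 -> a *m N = g *m N ^+ j.+1 ->
  cl (above k.+1) (N, N', h).
Proof.
move=> km [/= Nm N'm Nh] Nk jk N'j ghN' gNk ah aN.
have [y ghy] := exists_col_neq0 ghN'.
(* Because [c] factors through [h], [N ^+ i *m c] vanishes for [i > j], and [a *m N ^+ i *m c] for
   all [i]. *)
pose c := h *m y.
have Nic i : N ^+ i *m c = h *m N' ^+ i *m y by rewrite mulmxA (intertwine_exp _ Nh).
have aNc i : a *m N ^+ i *m c = 0 by rewrite -mulmxA Nic !mulmxA ah !mul0mx.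
clearbody c; pose B := c *m a.
have aNi i : a *m N ^+ i.+1 = g *m N ^+ (j.+1 + i).
  by rewrite mulmx_expS aN mulmx_expD.
have Nk0 i : (k < i)%N -> N ^+ i = 0 by apply: expr0_leq.
apply: (@zclosure_line _ _ _ _ B 0 0) => t t0; rewrite !scaler0 !addr0.
have pow i : (N + t *: B) ^+ i =
    N ^+ i + t *: \sum_(l < i) (N ^+ l *m c) *m (a *m N ^+ (i - 1 - l)).
  rewrite expr_addr_sandwich0 => [|l].
    congr (_ + _); rewrite scaler_sumr; apply: eq_bigr => l _.
    by rewrite -!mulmxE -scalemxAr -scalemxAl /B !mulmxA.
  rewrite -!mulmxE -!scalemxAl -!scalemxAr /B.
  by rewrite !mulmxA -(mulmxA c) -(mulmxA c) aNc mulmx0 mul0mx !scaler0.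
(* Only [l = j] contributes: smaller [l] produce a power of [N] above [k], larger [l] kill the
   column factor. *)
have powk : (N + t *: B) ^+ k.+1 =
    t *: (N ^+ j *m c *m (g *m N ^+ k)).
  have jk1 : (j < k.+1)%N by rewrite ltnS ltnW.
  rewrite pow Nk add0r (bigD1 (Ordinal jk1)) //= big1 ?addr0 => [|l].
    rewrite subn1 /= -(subnSK jk) aNi; congr (_ *: (_ *m (g *m N ^+ _))).
    by rewrite subnKC.
  rewrite -val_eqE /= neq_ltn => /orP[/= lj|/= jl].
    by rewrite subn1 /= -(subnSK (ltn_trans lj jk)) aNi (Nk0 (_ + _)%N) ?mulmx0 //; lia.
  by rewrite Nic (expr0_leq N'j) // mulmx0 !mul0mx.
have powk1 : (N + t *: B) ^+ k.+2 = 0.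
  rewrite pow (Nk0 k.+2) // add0r big1 ?scaler0 // => l _.
  case: (leqP l j) => [lj|jl]; last by rewrite Nic (expr0_leq N'j) // mulmx0 !mul0mx.
  rewrite subn1 /= subSn; last exact: leq_trans lj (ltnW jk).
  by rewrite aNi (Nk0 (_ + _)%N) ?mulmx0 //; lia.
split=> [|/=].
  split=> //=; first exact: expr0_leq powk1 _.
  by rewrite mulmxDl Nh -scalemxAl -mulmxA ah mulmx0 scaler0 addr0.
rewrite powk scalemx_eq0 negb_or t0 mul_col_row_neq0 //.
apply: contraNneq ghy => Njc; by rewrite -!mulmxA (mulmxA h) -Nic Njc mulmx0.
Qed.

(** Intertwiners form a linear space, so [h] can move along a line in it; this serves to attain
    nonvanishing conditions on [h]. *)
Lemma perturb_map (N : 'M[K]_d) (N' : 'M[K]_e) (h C : 'M[K]_(d, e)) A :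
  hom_variety m (N, N', h) -> N *m C = C *m N' ->
  (forall t, t != 0 -> hom_variety m (N, N', h + t *: C) -> A (N, N', h + t *: C)) ->
  cl A (N, N', h).
Proof.
move=> [/= Nm N'm Nh] NC At.
apply: (@zclosure_line _ _ _ _ 0 0 C) => t t0; rewrite !scaler0 !addr0.
apply: At => //; split=> //=.
by rewrite mulmxDr mulmxDl Nh -scalemxAr -scalemxAl NC.
Qed.

End Deformations.

(** * Raising the nilpotency index of the source *)

Section Raise.
Variables (K : closedFieldType) (m d e k : nat) (N : 'M[K]_d).
Hypotheses (km : (k.+1 < m)%N) (md : (m <= d)%N).
Hypotheses (Nk : N ^+ k.+1 = 0) (Nk0 : N ^+ k != 0).

Local Notation cl := (zclosure (@hom_coord K d e)).
Local Notation above := (hom_variety_index_gt m k.+1).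

(** If [h] is injective, [e <= d] makes it invertible and its kernel puts no condition on [c].
    Otherwise there is a common kernel vector [f], which automatically kills [h *m y]. *)
Lemma raise_long_image (N' : 'M[K]_e) (h : 'M[K]_(d, e)) :
  (e <= d)%N -> hom_variety m (N, N', h) -> N ^+ k *m h != 0 ->
  cl above (N, N', h).
Proof.
move=> ed hv Nkh; have [/= Nm N'm Nh] := hv.
case: (boolP (row_free h)) => [free|nfree].
  have full : row_full h.
    by rewrite -col_leq_rank; apply: leq_trans ed _; rewrite row_leq_rank.
  have [g gNk] := exists_row_neq0 Nk0.
  have [c [c0 /eqP]] := exists_functional_kill_radical g Nk (leq_trans km md).
  rewrite mul_col_mx col_mx_eq0 => /andP[/eqP Nc /eqP gc].
  apply: (@raise_surjective _ _ _ _ k _ _ _ g c) => //.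
  by move: free; rewrite -kermx_eq0 => /eqP ->; rewrite mul0mx.
have [f [f0 fN fh]] := common_kernel Nh Nm nfree.
have [y Nkhy] := exists_col_neq0 Nkh.
apply: (@raise_kernel _ _ _ _ k _ _ _ f (h *m y)) => //; last by rewrite mulmxA.
by rewrite mulmxA fh mul0mx.
Qed.

Lemma raise_long_target (N' : 'M[K]_e) (h : 'M[K]_(d, e)) :
  (e <= d)%N -> hom_variety m (N, N', h) -> N' ^+ k != 0 -> cl above (N, N', h).
Proof.
move=> ed hv N'k; have [/= Nm N'm Nh] := hv.
case: (eqVneq (N ^+ k *m h) 0) => [Nkh|]; last exact: raise_long_image.
have [y Nky] := exists_col_neq0 Nk0.
have ex : exists j, N' ^+ j == 0 by exists m; apply/eqP.
case: (ex_minnP ex) => j /eqP N'j minj.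
have kj : (k < j)%N by rewrite ltnNge; apply: contra N'k => /(expr0_leq N'j) ->.
have /exists_row_neq0[v vN'] : N' ^+ j.-1 != 0.
  by apply/negP => /minj; rewrite -{1}(ltn_predK kj) ltnn.
(* Here [j] is the index of [N']; the shift gives a vector whose last nonzero iterate is the [k]-th,
   so the norm map built from it intertwines and [N ^+ k] does not kill it. *)
pose w := v *m N' ^+ (j.-1 - k).
have wN'k : w *m N' ^+ k != 0 by rewrite mulmx_expD subnK // -ltnS (ltn_predK kj).
have wN'k1 : w *m N' ^+ k.+1 = 0.
  by rewrite mulmx_expD addnS subnK ?(ltn_predK kj) ?N'j ?mulmx0 // -ltnS (ltn_predK kj).
apply/zclosure_idem/(perturb_map hv (norm_hom_intertwine y Nk wN'k1)) => t t0 hvt.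
apply: raise_long_image => //.
rewrite mulmxDr Nkh add0r -scalemxAr exp_mul_norm_hom // scalemx_eq0 negb_or t0.
exact: mul_col_row_neq0.
Qed.

(** Three cases: some [f] in both kernels spans a line not containing the image of [N ^+ k]; the
    chain of [g] extends inside [kermx h]; or [kermx h] lies in the span of [N] and [g], and a
    functional killing that span serves for [raise_surjective]. *)
Lemma raise_short_quotient j (N' : 'M[K]_e) (h : 'M[K]_(d, e)) :
  (j <= k)%N -> hom_variety m (N, N', h) -> N' ^+ j = 0 ->
  ((0 < j)%N -> h *m N' ^+ j.-1 != 0) -> row_full h -> cl above (N, N', h).
Proof.
move=> jk hv N'j hN'j full; have [/= Nm N'm Nh] := hv.
have [g [gNk ghN']] : exists g : 'rV_d,
    g *m N ^+ k != 0 /\ ((0 < j)%N -> g *m (h *m N' ^+ j.-1) != 0).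
  case: (posnP j) => [j0|/hN'j hN'].
    by have [g gNk] := exists_row_neq0 Nk0; exists g.
  by have [g [gNk ghN']] := exists_row_neq0_both Nk0 hN'; exists g.
case: (classic (exists f : 'rV_d,
    [/\ f != 0, f *m N = 0, f *m h = 0 & ~~ (N ^+ k <= f)%MS])) => [|noF].
  move=> [f [f0 fN fh]]; rewrite submxE => /exists_col_neq0[y Ny].
  apply: (@raise_kernel _ _ _ _ k _ _ _ f (cokermx f *m y)) => //.
    by rewrite mulmxA mulmx_coker mul0mx.
  by rewrite mulmxA.
(* Both sides lie in [kermx h], as [N' ^+ j = 0]; a solution [D] yields the vector [a] of
   [raise_extension]. *)
case: (boolP (g *m N ^+ j <= kermx h *m N)%MS) => [/submxP[D gNj]|gNj].
  have Dh : D *m kermx h *m h = 0 by rewrite -mulmxA mulmx_ker mulmx0.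
  rewrite mulmxA in gNj.
  case: j => [|j] in jk N'j hN'j ghN' gNj *.
    rewrite expr0 mulmx1 in gNj.
    by rewrite gNj -mulmx_expS Nk mulmx0 eqxx in gNk.
  apply: (@raise_extension _ _ _ _ k j _ _ _ g (D *m kermx h)) => //.
  by rewrite -mulmxA; apply: ghN'.
have [c [c0 Ngc]] := exists_functional_kill_radical g Nk (leq_trans km md).
suff KNg : (kermx h <= col_mx N g)%MS.
  have Kc : kermx h *m c = 0.
    by have /submxP[D ->] := KNg; rewrite -mulmxA Ngc mulmx0.
  move/eqP: Ngc; rewrite mul_col_mx col_mx_eq0 => /andP[/eqP Nc /eqP gc].
  exact: (@raise_surjective _ _ _ _ k _ _ _ g c).
(* [kermx h :&: kermx N] is at most a line, hence [kermx h *m N] has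
   codimension at most one in [kermx h]. *)
have rankX : (\rank (kermx h :&: kermx N)%MS <= 1)%N.
  set X := (_ :&: _)%MS.
  have XNk (f : 'rV_d) : f != 0 -> (f <= X)%MS -> (N ^+ k <= f)%MS.
    move=> f0; rewrite sub_capmx => /andP[/sub_kermxP fh /sub_kermxP fN].
    by apply: contraT => nf; case: noF; exists f.
  (* A nonzero [N ^+ k] inside the line of a row has that line as its row space. *)
  have XsubNk : (X <= N ^+ k)%MS.
    apply/row_subP => i; case: (eqVneq (row i X) 0) => [->|Xi]; first exact: sub0mx.
    have NkX := XNk _ Xi (row_sub i X).
    rewrite -(geq_leqif (mxrank_leqif_sup NkX)).
    by apply: leq_trans (rank_leq_row _) _; rewrite lt0n mxrank_eq0.
  case: (eqVneq X 0) => [->|/exists_row_neq0[u uX]]; first by rewrite mxrank0.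
  apply: leq_trans (mxrankS XsubNk) _.
  by apply: leq_trans (mxrankS (XNk _ uX (submxMl _ _))) (rank_leq_row _).
have KN : (kermx h *m N <= kermx h)%MS.
  by apply/sub_kermxP; rewrite -mulmxA Nh mulmxA mulmx_ker mul0mx.
have gK : (g *m N ^+ j <= kermx h)%MS.
  by apply/sub_kermxP; rewrite -mulmxA (intertwine_exp _ Nh) N'j !mulmx0.
have KNgK : (kermx h *m N + g *m N ^+ j <= kermx h)%MS by rewrite addsmx_sub KN.
have : (kermx h <= kermx h *m N + g *m N ^+ j)%MS.
  rewrite -(geq_leqif (mxrank_leqif_sup KNgK)).
  rewrite -(mxrank_mul_ker (kermx h) N) addnC.
  apply: leq_trans (leq_add rankX (leqnn _)) _; rewrite add1n; apply: rank_ltmx.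
  by rewrite /ltmx addsmxSl addsmx_sub submx_refl.
move/submx_trans; apply; rewrite -addsmxE; rewrite addsmx_sub.
rewrite (submx_trans (submxMl _ _)) ?addsmxSl //.
case: j {jk N'j hN'j ghN' gNj gK KNgK} => [|j]; first by rewrite expr0 mulmx1 addsmxSr.
by rewrite mulmx_expSr (submx_trans (submxMl _ _)) ?addsmxSl.
Qed.

End Raise.

Lemma raise_index (K : closedFieldType) m d e k (N : 'M[K]_d) (N' : 'M[K]_e)
    (h : 'M[K]_(d, e)) :
  (k.+1 < m)%N -> (m <= d)%N -> (e <= d)%N -> hom_variety m (N, N', h) ->
  N ^+ k.+1 = 0 -> N ^+ k != 0 ->
  zclosure (@hom_coord K d e) (hom_variety_index_gt m k.+1) (N, N', h).
Proof.
move=> km md ed hv Nk Nk0.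
(* As long as the index [j] of [N'] is at most [k], either [h] is onto, or [j]
   can be raised as well; induct on [k.+1 - j]. *)
have key n : forall j N' h, (j + n)%N = k.+1 -> hom_variety m (N, N', h) ->
    N' ^+ j = 0 -> ((0 < j)%N -> N' ^+ j.-1 != 0) ->
    zclosure (@hom_coord K d e) (hom_variety_index_gt m k.+1) (N, N', h).
  elim: n => [|n IH] j {hv}N' {}h.
    rewrite addn0 => -> hv _ /(_ isT) /= N'k.
    exact: (@raise_long_target K m d e k).
  move=> jn hv N'j N'j0; have jk : (j <= k)%N by lia.
  have core (h1 : 'M[K]_(d, e)) : hom_variety m (N, N', h1) ->
      ((0 < j)%N -> h1 *m N' ^+ j.-1 != 0) ->
      zclosure (@hom_coord K d e) (hom_variety_index_gt m k.+1) (N, N', h1).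
    move=> hv1 hN'j; case: (boolP (row_full h1)) => [|nf].
      exact: (@raise_short_quotient K m d e k _ _ _ _ _ j).
    have [/= _ N'm Nh] := hv1; have [c [c0 N'c hc]] := common_cokernel Nh N'm nf.
    case: (posnP j) => [j0|j_gt0].
      (* For [j = 0] the target is the zero space, which has no nonzero column. *)
      by rewrite j0 expr0 in N'j; case/eqP: c0; rewrite -[c]mul1mx idmxE N'j mul0mx.
    have [u uhN'] := exists_row_neq0 (hN'j j_gt0).
    case: j j_gt0 => // j _ in jn jk N'j N'j0 hN'j uhN' *.
    (* The row [u *m h1] vanishes on [c] because [h1 *m c = 0], while its [j]-th iterate under [N']
       is nonzero. *)
    apply/zclosure_idem/(@raise_target K m d e j N N' h1 (u *m h1) c) => //.
    - by lia.
    - by rewrite -mulmxA hc mulmx0.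
    - by rewrite -mulmxA.
    - by move=> N'' hv2 N''j N''j0; apply: (IH j.+2) => //; rewrite addSnnS.
  case: (posnP j) => [j0|j_gt0]; first by apply: core => //; rewrite j0.
  case: (eqVneq (h *m N' ^+ j.-1) 0) => [hN'|hN']; last exact: core.
  (* If [h] kills the last nonzero power of [N'], adding a norm map to [h] repairs this; [j <= k]
     makes that map an intertwiner. *)
  have [y Nky] := exists_col_neq0 Nk0.
  have [v vN'] := exists_row_neq0 (N'j0 j_gt0).
  have vN'j : v *m N' ^+ j.-1.+1 = 0 by rewrite prednK // N'j mulmx0.
  have vN'k : v *m N' ^+ k.+1 = 0.
    by rewrite (expr0_leq N'j) ?mulmx0 //; apply: leq_trans jk _.
  apply/zclosure_idem/(perturb_map hv (norm_hom_intertwine y Nk vN'k)) => t t0 hvt.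
  apply: core => // _.
  rewrite mulmxDl hN' add0r -scalemxAl norm_hom_mul_exp // scalemx_eq0 negb_or t0.
  exact: mul_col_row_neq0.
have [/= _ N'm _] := hv.
have ex : exists j, N' ^+ j == 0 by exists m; apply/eqP.
case: (ex_minnP ex) => j /eqP N'j minj.
have N'j0 : (0 < j)%N -> N' ^+ j.-1 != 0.
  by move=> j0; apply/negP => /minj; rewrite -{1}(ltn_predK j0) ltnn.
case: (leqP j k.+1) => [jk|kj]; first by apply: (key (k.+1 - j)%N j); rewrite ?subnKC.
apply: (@raise_long_target K m d e k) => //.
apply/eqP => N'k; have /minj : N' ^+ k == 0 by apply/eqP.
by rewrite leqNgt (ltn_trans (ltnSn k) kj).
Qed.

Lemma hom_variety_dense (K : closedFieldType) m d e k
    (p : 'M[K]_d * 'M[K]_e * 'M[K]_(d, e)) :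
  (k < m)%N -> (m <= d)%N -> (e <= d)%N -> hom_variety m p ->
  zclosure (@hom_coord K d e) (hom_variety_index_gt m k) p.
Proof.
move=> km md ed hv; elim: k km => [|k IH] km.
  apply: sub_zclosure; split=> //; rewrite expr0 -idmxE -mxrank_eq0 mxrank1 -lt0n.
  exact: leq_trans md.
apply/zclosure_idem/(zclosure_sub _ (IH (ltnW km))) => -[[N N'] h] [hv' /= Nk].
case: (eqVneq (N ^+ k.+1) 0) => [Nk1|Nk1]; last exact: sub_zclosure.
exact: raise_index.
Qed.

(** * Splitting off a free summand *)

Section Shift.
Variables (K : fieldType) (m : nat).

(** Multiplication by [x] on [K[x]/(x^(m+1))] in the monomial basis, acting on row vectors. *)
Definition shift_mx : 'M[K]_m.+1 := \matrix_(i, j) (j == i.+1 :> nat)%:R.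

(** When [v *m N ^+ m.+1 = 0], this is the [K[x]]-linear map from [K[x]/(x^(m+1))] that sends 1 to
    [v]. *)
Definition orbit_mx e (N : 'M[K]_e) (v : 'rV_e) : 'M_(m.+1, e) :=
  \matrix_(i < m.+1) (v *m N ^+ i).

Lemma row_shift_mx i :
  row i shift_mx = if (i < m)%N then delta_mx 0 (inord i.+1) else 0.
Proof.
apply/rowP => j; rewrite !mxE; case: ltnP => im; rewrite !mxE /=.
  by rewrite -val_eqE /= inordK.
by case: eqP => // ji; have := ltn_ord j; rewrite ji ltnS ltnNge im.
Qed.

Lemma shift_mx_orbit e (N : 'M[K]_e) v : v *m N ^+ m.+1 = 0 ->
  shift_mx *m orbit_mx N v = orbit_mx N v *m N.
Proof.
move=> vN; apply/row_matrixP => i.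
rewrite !row_mul row_shift_mx !rowK -mulmx_expSr; case: ltnP => im.
  by rewrite -rowE rowK inordK.
rewrite mul0mx; have -> : nat_of_ord i = m by apply/eqP; rewrite eqn_leq im -ltnS ltn_ord.
by rewrite vN.
Qed.

Lemma mul_shift_mx p (A : 'M[K]_(p, m.+1)) i j :
  (A *m shift_mx) i j = if nat_of_ord j is j'.+1 then A i (inord j') else 0.
Proof.
rewrite mxE; case: j => -[|j] jm /=.
  by rewrite big1 // => l _; rewrite mxE mulr0.
rewrite (bigD1 (inord j)) //= mxE /= inordK ?eqxx ?mulr1 1?ltnW //.
rewrite big1 ?addr0 // => l; rewrite mxE /= eqSS -val_eqE /= inordK 1?ltnW // => /negPf lj.
by rewrite eq_sym lj mulr0.
Qed.

Lemma mul_shift_mx_exp p (A : 'M[K]_(p, m.+1)) l i j :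
  (A *m shift_mx ^+ l) i j = if (j < l)%N then 0 else A i (inord (j - l)).
Proof.
elim: l j => [|l IH] j; first by rewrite expr0 mulmx1 subn0 inord_val.
rewrite mulmx_expSr mul_shift_mx; case: j => -[|j] jm //=.
by rewrite IH inordK ?subSS // ltnW.
Qed.

Lemma shift_mx_nilpotent : shift_mx ^+ m.+1 = 0.
Proof.
by apply/matrixP => i j; rewrite -[_ ^+ _]mul1mx mul_shift_mx_exp ltn_ord mxE.
Qed.

Lemma shift_mx_exp_neq0 : shift_mx ^+ m != 0.
Proof.
apply/eqP => /matrixP/(_ ord0 ord_max).
rewrite -[_ ^+ _]mul1mx mul_shift_mx_exp /= ltnn subnn !mxE.
have -> : inord 0 = ord0 :> 'I_m.+1 by apply: val_inj; rewrite /= inordK.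
by rewrite eqxx => /eqP; rewrite oner_eq0.
Qed.

End Shift.

Lemma block_diag_exp (K : fieldType) p q (A : 'M[K]_p) (B : 'M[K]_q) j :
  block_mx A 0 0 B ^+ j = block_mx (A ^+ j) 0 0 (B ^+ j).
Proof.
elim: j => [|j IH]; first by rewrite !expr0 -!idmxE scalar_mx_block.
by rewrite !exprS IH -!mulmxE mulmx_block !mul0mx !mulmx0 !addr0 !add0r.
Qed.

(* A block of maximal size of a nilpotent matrix splits off: the functionals
   [N ^+ j *m y] with [x *m N ^+ m *m y != 0] cut out a stable complement. *)
Lemma exists_cyclic_summand (K : fieldType) m d (N : 'M[K]_(d + m.+1)) :
  N ^+ m.+1 = 0 -> N ^+ m != 0 ->
  exists (C : 'M_(d, d + m.+1)) (x : 'rV_(d + m.+1)) (N1 : 'M_d),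
    [/\ col_mx C (orbit_mx m N x) \in unitmx, N1 ^+ m.+1 = 0 & C *m N = N1 *m C].
Proof.
move=> Nm1 Nm; have [x /exists_col_neq0[y xNy]] := exists_row_neq0 Nm.
pose J := shift_mx K m; pose B := orbit_mx m N x.
pose Y := (orbit_mx m N^T y^T)^T.
have JB : J *m B = B *m N by rewrite shift_mx_orbit // Nm1 mulmx0.
have NY : N *m Y = Y *m J^T.
  apply: trmx_inj; rewrite !trmx_mul !trmxK -shift_mx_orbit //.
  by rewrite -trmx_exp Nm1 trmx0 mulmx0.
(* A nonzero kernel of [B *m Y] is stable under the nilpotent [J], so it would contain the last
   basis vector; but that row of [B] pairs with [y] to the nonzero [x *m N ^+ m *m y]. *)
have freeBY : row_free (B *m Y).
  apply/negPn/negP => nf.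
  have inter : J *m (B *m Y) = (B *m Y) *m J^T by rewrite mulmxA JB -mulmxA NY mulmxA.
  have [f [f0 fJ fBY]] := common_kernel inter (shift_mx_nilpotent K m) nf.
  have fi i : i != ord_max -> f 0 i = 0.
    move=> im; have im' : (i < m)%N.
      by rewrite ltn_neqAle -ltnS ltn_ord andbT.
    have /rowP/(_ (inord i.+1)) := fJ.
    by rewrite mul_shift_mx inordK //= inord_val mxE.
  have fE : f = f 0 ord_max *: delta_mx 0 ord_max.
    apply/rowP => i; rewrite !mxE /=; case: (eqVneq i ord_max) => [->|/fi->].
      by rewrite mulr1.
    by rewrite mulr0.
  have colY : col ord0 Y = y by rewrite -tr_row rowK expr0 mulmx1 trmxK.
  move: fBY; rewrite fE -scalemxAl -rowE row_mul rowK =>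
    /(congr1 (fun A => A *m (delta_mx ord0 0 : 'cV_m.+1))).
  rewrite -scalemxAl -mulmxA -colE colY mul0mx => /eqP; rewrite scalemx_eq0 (negPf xNy) orbF.
  by move=> /eqP fm; rewrite fE fm scale0r eqxx in f0.
have rankY : \rank (kermx Y) = d.
  have rY : \rank Y = m.+1.
    apply/eqP; rewrite eqn_leq rank_leq_col /=.
    by move: freeBY => /eqP {1}<-; apply: mxrankM_maxr.
  by rewrite mxrank_ker rY addnK.
have [C eqC] : exists C : 'M[K]_(d, d + m.+1), (C :=: kermx Y)%MS.
  (* Abstracting the row count turns a basis with [\rank (kermx Y)] rows into one with [d] rows. *)
  have gen D r r' (W : 'M[K]_(r, D)) : r = r' ->
      exists C : 'M[K]_(r', D), (C :=: W)%MS by move=> <-; exists W.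
  have [C eqC] := gen _ _ _ (row_base (kermx Y)) rankY.
  by exists C; apply: eqmx_trans eqC (eq_row_base _).
have CY : C *m Y = 0 by apply/sub_kermxP; rewrite eqC.
have freeC : row_free C by rewrite /row_free eqC rankY.
have /submxP[N1 CN] : (C *m N <= C)%MS.
  by rewrite eqC; apply/sub_kermxP; rewrite -mulmxA NY mulmxA CY mul0mx.
exists C, x, N1; split=> //.
  (* Multiplying a relation by [Y] kills [C] and isolates the coefficients of the orbit. *)
  rewrite -row_free_unit; apply: inj_row_free => u.
  rewrite -[u]hsubmxK mul_row_col => uCB.
  have ur : rsubmx u = 0.
    apply: (row_free_inj freeBY); rewrite mul0mx mulmxA -[LHS]add0r.
    by rewrite -[in LHS](mulmx0 _ (lsubmx u)) -CY mulmxA -mulmxDl uCB mul0mx.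
  have ul : lsubmx u = 0.
    by apply: (row_free_inj freeC); rewrite mul0mx -uCB ur mul0mx addr0.
  by rewrite ul ur row_mx0.
apply: (row_free_inj freeC); rewrite mul0mx.
by rewrite (intertwine_exp (N := N1) (N' := N) _ (esym CN)) Nm1 mulmx0.
Qed.

Lemma conj_exp (K : fieldType) n (g A : 'M[K]_n) j : g \in unitmx ->
  (invmx g *m A *m g) ^+ j = invmx g *m A ^+ j *m g.
Proof.
move=> gu; elim: j => [|j IH]; first by rewrite !expr0 mulmx1 mulVmx.
by rewrite !exprS IH -!mulmxE !mulmxA mulmxK.
Qed.

Section Coordinates.
Variables (K : fieldType) (T I : Type) (c : I -> T -> K) (X : T -> Prop) (d e : nat).

Lemma regular_hom_coord (phi : T -> 'M[K]_d * 'M[K]_e * 'M[K]_(d, e)) :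
  regular_mx c X (fun x => (phi x).1.1) -> regular_mx c X (fun x => (phi x).1.2) ->
  regular_mx c X (fun x => (phi x).2) ->
  forall i, regular c X (fun x => hom_coord i (phi x)).
Proof. by move=> r1 r2 r3 [[[i j]|[i j]]|[i j]]; [apply: r1|apply: r2|apply: r3]. Qed.

End Coordinates.

Lemma regular_mx_orbit (K : fieldType) (T I : Type) (c : I -> T -> K) (X : T -> Prop)
    m e (N : T -> 'M[K]_e) (v : T -> 'rV_e) :
  regular_mx c X N -> regular_mx c X v ->
  regular_mx c X (fun x => orbit_mx m (N x) (v x)).
Proof.
move=> rN rv i j; apply: (@eq_regular _ _ _ _ _ (fun x => (v x *m N x ^+ i) 0 j)).
  by move=> x _; rewrite [RHS]mxE.
by apply: regular_mxM => //; apply: regular_mxX.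
Qed.

(** The parameters are a smaller triple, a base change [g] and a vector [v]: the source is a
    conjugate of [N1] plus a free block, and on that block [h] is determined by the image [v] of the
    generator. *)
Lemma hom_variety_split_irreducible (K : closedFieldType) m d e :
  irreducible_set (@hom_coord K d e) (@hom_variety K m.+1 d e) ->
  irreducible_set (@hom_coord K (d + m.+1) e)
    (@hom_variety_index_gt K m.+1 (d + m.+1) e m).
Proof.
move=> /(irreducible_set_prod_mx (d + m.+1) (d + m.+1))/(irreducible_set_prod_mx 1 e).
set c := prod_coord _ _ => irr.
pose P := ('M[K]_d * 'M[K]_e * 'M[K]_(d, e) * 'M[K]_(d + m.+1) * 'rV[K]_e)%type.
have rN1 X : regular_mx c X (fun p : P => p.1.1.1.1).
  by move=> i j; apply: regular_poly (pf_coord c (inl (inl (inl (inl (i, j)))))).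
have rN' X : regular_mx c X (fun p : P => p.1.1.1.2).
  by move=> i j; apply: regular_poly (pf_coord c (inl (inl (inl (inr (i, j)))))).
have rh1 X : regular_mx c X (fun p : P => p.1.1.2).
  by move=> i j; apply: regular_poly (pf_coord c (inl (inl (inr (i, j))))).
have rg X : regular_mx c X (fun p : P => p.1.2).
  by move=> i j; apply: regular_poly (pf_coord c (inl (inr (i, j)))).
have rv X : regular_mx c X (fun p : P => p.2).
  by move=> i j; apply: regular_poly (pf_coord c (inr (i, j))).
have {}irr : irreducible_set c (fun p => hom_variety m.+1 p.1.1 /\ \det p.1.2 != 0).
  apply: (irreducible_set_open (regular_det (rg _)) irr).
  by case: irr => -[[[p g] v] hp] _; exists (p, 1%:M, v); rewrite //= det1 oner_neq0.
pose phi (p : P) :=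
  (invmx p.1.2 *m block_mx p.1.1.1.1 0 0 (shift_mx K m) *m p.1.2, p.1.1.1.2,
   invmx p.1.2 *m col_mx p.1.1.2 (orbit_mx m p.1.1.1.2 p.2)).
apply: (irreducible_set_image (phi := phi) _ _ _ irr).
- have gu (p : P) : hom_variety m.+1 p.1.1 /\ \det p.1.2 != 0 -> p.1.2 \in unitmx.
    by case=> _ det_g; rewrite unitmxE unitfE.
  apply: regular_hom_coord => /=; first 2 last.
  + apply: regular_mxM; first exact: regular_invmx.
    by apply: regular_col_mx => //; apply: regular_mx_orbit.
  + apply: regular_mxM => //; apply: regular_mxM; first exact: regular_invmx.
    apply: regular_col_mx; apply: regular_row_mx => //; exact: regular_mx_const.
  + exact: rN'.
- move=> [[[[N1 N'] h1] g] v] [[/= N1m N'm N1h] det_g].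
  have gu : g \in unitmx by move: det_g; rewrite /= -unitfE -unitmxE.
  have conj_eq0 A : invmx g *m A *m g = 0 -> A = 0.
    move=> A0; rewrite -[A](mulKVmx gu) -[X in g *m X](mulmxK gu).
    by rewrite A0 mul0mx mulmx0.
  rewrite /phi; split=> /=; last first.
    rewrite conj_exp // block_diag_exp; apply/eqP => /conj_eq0/(congr1 drsubmx).
    rewrite -[in RHS](block_mx0 _ d m.+1 d m.+1) !block_mxKdr => /eqP.
    by rewrite (negPf (shift_mx_exp_neq0 K m)).
  split=> //=.
    by rewrite conj_exp // block_diag_exp N1m shift_mx_nilpotent block_mx0 mulmx0 mul0mx.
  rewrite -!mulmxA mulKVmx // mul_block_col !mul0mx addr0 add0r mul_col_mx N1h.
  by rewrite shift_mx_orbit // N'm mulmx0.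
move=> [[N N'] h] [[/= Nm N'm Nh] Nm0].
have [C [x [N1 [gu N1m CN]]]] := exists_cyclic_summand Nm Nm0.
set g := col_mx C _ in gu.
(* [g] is a basis adapted to the splitting; [h] is recorded by its restriction to [C] and its value
   on the generator [x]. *)
exists (N1, N', C *m h, g, x *m h).
  by split=> /=; [split=> //=; rewrite !mulmxA -CN -!mulmxA Nh | rewrite -unitfE -unitmxE].
rewrite /phi /=; congr (_, _, _).
  rewrite -mulmxA; have -> : block_mx N1 0 0 (shift_mx K m) *m g = g *m N.
    rewrite mul_block_col !mul0mx addr0 add0r mul_col_mx CN.
    by rewrite shift_mx_orbit // Nm mulmx0.
  by rewrite mulKmx.
have -> : orbit_mx m N' (x *m h) = orbit_mx m N x *m h.
  apply/row_matrixP => i; rewrite row_mul !rowK -!mulmxA.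
  by rewrite (intertwine_exp _ Nh).
by rewrite -mul_col_mx mulKmx.
Qed.

(** * Irreducibility of the variety of triples *)

Lemma hom_variety_transpose (K : fieldType) m d e :
  irreducible_set (@hom_coord K d e) (@hom_variety K m d e) ->
  irreducible_set (@hom_coord K e d) (@hom_variety K m e d).
Proof.
pose tr d e (p : 'M[K]_d * 'M[K]_e * 'M[K]_(d, e)) := (p.1.2^T, p.1.1^T, p.2^T).
have trH d' e' p : @hom_variety K m d' e' p -> hom_variety m (tr _ _ p).
  by case: p => [[N N'] h] [/= Nm N'm Nh]; split;
    rewrite /= -?trmx_exp ?Nm ?N'm ?trmx0 // -!trmx_mul Nh.
apply: (irreducible_set_image (phi := tr d e)).
- apply: regular_hom_coord => /=; apply: regular_mx_tr => i j.
  + exact: regular_poly (pf_coord (@hom_coord K d e) (inl (inr (i, j)))).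
  + exact: regular_poly (pf_coord (@hom_coord K d e) (inl (inl (i, j)))).
  + exact: regular_poly (pf_coord (@hom_coord K d e) (inr (i, j))).
- exact: trH.
- move=> [[N N'] h] /trH hv; exists (tr _ _ (N, N', h)) => //.
  by rewrite /tr /= !trmxK.
Qed.

(** The row space of a nonzero [N ^+ j] is stable and so meets the kernel of [N]; the ranks drop
    strictly until they reach 0. *)
Lemma nilpotent_exp_dim (K : fieldType) m d (N : 'M[K]_d) : N ^+ m = 0 -> N ^+ d = 0.
Proof.
move=> Nm; suff rankN j : (\rank (N ^+ j) <= d - j)%N.
  by apply/eqP; rewrite -mxrank_eq0 -leqn0 -(subnn d).
elim: j => [|j IH]; first by rewrite subn0 rank_leq_row.
case: (eqVneq (N ^+ j) 0) => [Nj|Nj]; first by rewrite exprS Nj mulr0 mxrank0.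
have [|f [f0 fNj fN]] := nilpotent_stable_kernel Nm Nj.
  by rewrite -[_ *m N]exprSr exprS submxMl.
have : (0 < \rank (N ^+ j :&: kermx N)%MS)%N.
  rewrite lt0n mxrank_eq0; apply: contraNneq f0 => X0.
  by rewrite -submx0 -X0 sub_capmx fNj; apply/sub_kermxP.
have := mxrank_mul_ker (N ^+ j) N; rewrite -[_ *m N]exprSr; lia.
Qed.

Theorem hom_variety_irreducible (K : closedFieldType) m d e :
  (0 < m)%N -> irreducible_set (@hom_coord K d e) (@hom_variety K m d e).
Proof.
have [s] := ubnP (d + e); elim: s => // s IH in m d e * => ds m0.
wlog ed : d e ds / (e <= d)%N => [wl|].
  case: (leqP e d) => [|/ltnW de]; first exact: wl.
  by apply: hom_variety_transpose; apply: wl => //; rewrite addnC.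
case: (posnP d) => [d0|d_gt0].
  have e0 : e = 0%N by lia.
  subst d e; have all_eq (p q : 'M[K]_0 * 'M[K]_0 * 'M[K]_(0, 0)) : p = q.
    case: p q => [[N N'] h] [[M M'] h'].
    by congr (_, _, _); rewrite [LHS]flatmx0 [RHS]flatmx0.
  split; first by exists (0, 0, 0); split; rewrite /= [LHS]flatmx0 // [RHS]flatmx0.
  move=> f g _ _ [x Xx fx] [y _ gy]; exists x; split=> //.
  by rewrite (all_eq x y).
have main m' : (0 < m')%N -> (m' <= d)%N ->
    irreducible_set (@hom_coord K d e) (@hom_variety K m' d e).
  move=> m'0 md; apply: (irreducible_set_dense (A := hom_variety_index_gt m' m'.-1)).
  - by move=> p [].
  - by move=> p; apply: hom_variety_dense => //; rewrite ltn_predL.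
  case: m' m'0 md => // m' _ md /=.
  (* Removing a block of size [m'.+1] brings the sum of the sizes below the bound of the
     induction. *)
  have dE : d = (d - m'.+1 + m'.+1)%N by rewrite subnK.
  rewrite dE; apply: hom_variety_split_irreducible; apply: IH => //; lia.
case: (leqP m d) => [|dm]; first exact: main.
(* For [m > d >= e] a nilpotent matrix of either size has [d]-th power 0, so the exponents [m] and
   [d] define the same set. *)
apply: (irreducible_set_dense (A := @hom_variety K d d e)); last exact: main.
  by move=> p [/= Nd N'd Nh]; split=> //; apply: expr0_leq (ltnW dm).
move=> p [/= Nm N'm Nh]; apply: sub_zclosure; split=> //.
  exact: nilpotent_exp_dim Nm.
exact: expr0_leq (nilpotent_exp_dim N'm) ed.
Qed.

(** * From triples to representations *)

Lemma block_triangular_exp (K : fieldType) p q (A : 'M[K]_p) B (D : 'M[K]_q) m :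
  block_mx A B 0 D ^+ m =
  block_mx (A ^+ m) (\sum_(i < m) A ^+ (m - 1 - i) *m B *m D ^+ i) 0 (D ^+ m).
Proof.
elim: m => [|m IH]; first by rewrite !expr0 big_ord0 -!idmxE scalar_mx_block.
rewrite [in LHS]exprS IH -mulmxE mulmx_block !mul0mx !mulmx0 !addr0 !add0r.
congr (block_mx _ _ _ _); rewrite ?mulmxE -?exprS //.
rewrite [RHS]big_ord_recr /= subSS subn0 subnn expr0 mul1mx; congr (_ + _).
rewrite mulmx_sumr; apply: eq_bigr => i _.
rewrite !mulmxA -[A *m _]exprS; congr (_ ^+ _ *m _ *m _).
by have := ltn_ord i; lia.
Qed.

Lemma repA_irreducible (K : closedFieldType) n m d0 d1 : (0 < m)%N -> (0 < n)%N ->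
  irreducible_set (@Qcoord K n d0 d1) (@repA K n m d0 d1).
Proof.
move=> m0 n0; have := hom_variety_irreducible K (d0 + d1) d0 m0.
move/(irreducible_set_prod_mx n (d0 * d1)); set c := prod_coord _ _ => irr.
pose P := ('M[K]_(d0 + d1) * 'M[K]_d0 * 'M[K]_(d0 + d1, d0) * 'M[K]_(n, d0 * d1))%type.
have rN X : regular_mx c X (fun p : P => p.1.1.1).
  by move=> i j; apply: regular_poly (pf_coord c (inl (inl (inl (i, j))))).
have rN' X : regular_mx c X (fun p : P => p.1.1.2).
  by move=> i j; apply: regular_poly (pf_coord c (inl (inl (inr (i, j))))).
have rh X : regular_mx c X (fun p : P => p.1.2).
  by move=> i j; apply: regular_poly (pf_coord c (inl (inr (i, j)))).
have ra X : regular_mx c X (fun p : P => p.2).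
  by move=> i j; apply: regular_poly (pf_coord c (inr (i, j))).
(* Where [h] and the last [d1] basis columns form an invertible [g], base change by [g] turns [h]
   into the standard projection [h0]. *)
pose g (p : P) := row_mx p.1.2 (col_mx 0 1%:M).
have rg X : regular_mx c X g.
  by apply: regular_row_mx => //; apply: regular_mx_const.
pose h0 : 'M[K]_(d0 + d1, d0) := col_mx 1%:M 0.
have g_h0 N N' a : g (N, N', h0, a) = 1%:M.
  by rewrite /g /h0 -block_mxEh -scalar_mx_block.
pose N_of (V : Qrep K n d0 d1) :=
  block_mx (rep_eps0 V) (rep_alpha V (Ordinal n0)) 0 (rep_eps1 V).
have hom_of V : repA m V -> hom_variety m (N_of V, rep_eps0 V, h0).
  case=> [N0m [N1m rel]]; split=> //=.
    by rewrite block_triangular_exp N0m N1m rel // block_mx0.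
  by rewrite mul_block_col mul_col_mx !mulmx1 !mulmx0 !mul0mx mul1mx !addr0.
have {}irr : irreducible_set c (fun p => hom_variety m p.1 /\ \det (g p) != 0).
  apply: (irreducible_set_open (regular_det (rg _)) irr).
  have V0 : repA m (mkQrep (0 : 'M[K]_d0) (0 : 'M[K]_d1) (fun _ : 'I_n => 0)).
    split=> /=; first by rewrite -(prednK m0) exprS mul0r.
    split=> /=; first by rewrite -(prednK m0) exprS mul0r.
    by move=> a _; apply: big1 => i _; rewrite mulmx0 mul0mx.
  exists (N_of (mkQrep 0 0 (fun=> 0)), 0, h0, 0); first exact: hom_of V0.
  by rewrite g_h0 det1 oner_neq0.
have gu (p : P) : hom_variety m p.1 /\ \det (g p) != 0 -> g p \in unitmx.
  by case=> _ det_g; rewrite unitmxE unitfE.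
pose M (p : P) := invmx (g p) *m p.1.1.1 *m g p.
have rM : regular_mx c (fun p => hom_variety m p.1 /\ \det (g p) != 0) M.
  by apply: regular_mxM => //; apply: regular_mxM => //; apply: regular_invmx.
(* The arrow of index 0 is read off [M]; each other arrow is a row of the free matrix factor,
   reshaped by [vec_mx]. *)
pose phi (p : P) := mkQrep p.1.1.2 (drsubmx (M p))
  (fun k : 'I_n => if nat_of_ord k == 0%N then ursubmx (M p) else vec_mx (row k p.2)).
apply: (irreducible_set_image (phi := phi) _ _ _ irr).
- case=> [[[i j]|[i j]]|[[k i] j]] /=.
  + exact: rN'.
  + by apply: eq_regular (rM (rshift d0 i) (rshift d0 j)) => p _; rewrite !mxE.
  + case: (nat_of_ord k == 0%N).
      by apply: eq_regular (rM (lshift d1 i) (rshift d0 j)) => p _; rewrite !mxE.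
    by apply: eq_regular (ra _ k (mxvec_index i j)) => p _; rewrite !mxE.
- move=> p hp; have gp := gu p hp; case: hp => [[Nm N'm Nh] _].
  have gh0 : g p *m h0 = p.1.2.
    by rewrite /g /h0 mul_row_col mulmx1 mulmx0 addr0.
  have Mh0 : M p *m h0 = h0 *m p.1.1.2.
    by rewrite /M -!mulmxA gh0 Nh -gh0 !mulmxA mulVmx // mul1mx.
  (* Commutation with [h0] forces the left block column of [M p] to be [p.1.1.2] over 0. *)
  have ME : M p = block_mx p.1.1.2 (ursubmx (M p)) 0 (drsubmx (M p)).
    move: Mh0; rewrite -[in LHS](submxK (M p)) mul_block_col mul_col_mx.
    rewrite !mulmx1 !mulmx0 !mul0mx mul1mx !addr0 => /eq_col_mx[ul dl].
    by rewrite -[LHS]submxK ul dl.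
  have Mm : M p ^+ m = 0 by rewrite conj_exp // Nm mulmx0 mul0mx.
  move: Mm; rewrite ME block_triangular_exp -block_mx0 => /eq_block_mx[_ urM _ drM].
  split=> //; split=> //= a a0.
  by rewrite a0 eqxx.
move=> V hV; exists (N_of V, rep_eps0 V, h0,
    \matrix_(k < n) mxvec (rep_alpha V k)).
  by split; [apply: hom_of | rewrite g_h0 det1 oner_neq0].
rewrite /phi /M g_h0 /= invmx1 mul1mx mulmx1 /N_of block_mxKdr block_mxKur.
case: V hV {hom_of} => V0 V1 al _ /=; congr mkQrep.
apply: functional_extensionality => k; case: eqP => [k0|_].
  by congr al; apply: val_inj.
by rewrite rowK mxvecK.
Qed.

Theorem theorem1p2 (K : closedFieldType) (m n : nat) :
  (2 <= m)%N -> (1 <= n)%N -> geometrically_irreducible_Anm K n m.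
Proof.
move=> m2 n1 d0 d1; apply: irreducible_set_zirreducible.
by apply: repA_irreducible => //; apply: ltnW.
Qed.
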